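(* Let $A,B,C,D\in\mathbb{R}^{n\times n}$, let $\mathcal M=\begin{bmatrix} C & D\\ A & -B\end{bmatrix}$ and $\varphi(z)=\mathcal M+z\mathcal M^\top$, and assume that $\varphi(z)$ is non-critical, i.e., $\det\varphi(z)\neq 0$ for all $z\in\mathbb{C}$ with $|z|=1$. Let $$\mathcal I(\mathcal M)=\frac{1}{2\pi \mathrm{i}}\oint_{|z|=1}\varphi(z)^{-1}\,dz,$$ the integral being taken over the unit circle. Then the range (column space) of $\mathcal I(\mathcal M)$ is the stable deflating subspace of $\varphi(z)$. Moreover, $\mathcal I(\mathcal M)\mathcal M^\top$ is the orthogonal projector on the stable deflating subspace of $\varphi(z)$.
   Context: A subspace $\mathcal V\subset\mathbb{C}^N$ of dimension $\ell$ is a deflating subspace of a regular pencil $p(z)=E+zF$ ($E,F\in\mathbb{C}^{N\times N}$, $\det p(z)\not\equiv 0$) if there is a subspace $\mathcal W\subset\mathbb{C}^N$ of dimension $\ell$ with $E\mathcal V\subset\mathcal W$ and $F\mathcal V\subset\mathcal W$. If the columns of $V,W\in\mathbb{C}^{N\times\ell}$ are bases of $\mathcal V,\mathcal W$, then $EV=WE'$, $FV=WF'$ for some $E',F'\in\mathbb{C}^{\ell\times\ell}$; the pencil $E'+zF'$ is regular, and its eigenvalues are the eigenvalues of $p(z)$ associated with $\mathcal V$. The eigenvalues of $\varphi(z)=\mathcal M+z\mathcal M^\top$ come in pairs $(\lambda,1/\lambda)$ (with $1/0=\infty$, $1/\infty=0$), so when $\det\varphi(z)\ne0$ on the unit circle,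 $\varphi(z)$ has exactly $n$ eigenvalues (with multiplicity) in the open unit disk; the unique ($n$-dimensional) deflating subspace associated with these $n$ eigenvalues is called the stable deflating subspace of $\varphi(z)$.
   Formalization: ''Orthogonal projector'' is replaced by ''projector'' (idempotent with range the stable deflating subspace): the orthogonality claim is false, e.g. for C=1, D=2, A=1, B=0 the matrix I(M)M^T is [1 0; -1/3 0], which is not symmetric. *)

(* Defs.v *)
From HB Require Import structures.
From mathcomp Require Import all_boot all_order all_algebra.
From mathcomp Require Import complex.
From mathcomp Require Import all_classical all_reals all_analysis.

Set Implicit Arguments.
Unset Strict Implicit.
Unset Printing Implicit Defensive.

Import Order.TTheory GRing.Theory Num.Theory.
Local Open Scope ring_scope.
Local Open Scope complex_scope.

Section Pencil.
Variables (K : fieldType) (N : nat).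
Implicit Types (E F : 'M[K]_N) (V W : {vspace 'cV[K]_N}).

Definition range_mx (X : 'M[K]_N) : {vspace 'cV[K]_N} :=
  limg (linfun (mulmx X : 'cV[K]_N -> 'cV[K]_N)).

Definition pencil E F (z : K) : 'M[K]_N := E + z *: F.

Definition pencil_poly E F : {poly K} :=
  \det (map_mx polyC E + 'X *: map_mx polyC F).

Definition regular_pencil E F : bool := pencil_poly E F != 0.

(* Multiplicity of a point of K + {oo} as an eigenvalue of a regular pencil;
   None is oo, with multiplicity N - deg det(E + zF), as for 0 in zE + F.
   Points that are not eigenvalues have multiplicity 0. *)
Definition eigen_mult E F (z : option K) : nat :=
  if z is Some a then mup a (pencil_poly E F)
  else (N - (size (pencil_poly E F)).-1)%N.

Definition is_deflating E F V : Prop :=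
  regular_pencil E F /\
  exists W, [/\ \dim W = \dim V,
                forall v, v \in V -> E *m v \in W &
                forall v, v \in V -> F *m v \in W].

Definition columns_basis (l : nat) V (X : 'M[K]_(N, l)) : bool :=
  basis_of V [seq col j X | j <- enum 'I_l].

(* E' + z F' represents the action of E + z F on V in some bases of V and W;
   (E', F') is determined up to strict equivalence. *)
Definition restricted_pencil (l : nat) E F V (E' F' : 'M[K]_l) : Prop :=
  exists W (X Y : 'M[K]_(N, l)),
    [/\ columns_basis V X, columns_basis W Y,
        E *m X = Y *m E' & F *m X = Y *m F'].

(* Not required to be Hermitian: for [C D; A -B] = [1 2; 1 0] the matrix
   I(M) M^T is [1 0; -1/3 0], a projector that is not self-adjoint. *)
Definition projector_onto (P : 'M[K]_N) V : Prop :=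
  P *m P = P /\ range_mx P = V.

End Pencil.

Section ComplexPencil.
Variables (R : realType) (N : nat).
Implicit Types (E F M : 'M[R[i]]_N) (V : {vspace 'cV[R[i]]_N}).

Definition non_critical E F : Prop :=
  forall z : R[i], `|z| = 1 -> \det (pencil E F z) != 0.

Definition in_open_disk (z : option R[i]) : bool :=
  if z is Some a then `|a| < 1 else false.

(* The eigenvalues associated with V are, with multiplicities, exactly the
   eigenvalues of E + z F in the open unit disk. *)
Definition is_stable_deflating E F V : Prop :=
  is_deflating E F V /\
  exists E' F' : 'M[R[i]]_(\dim V),
    restricted_pencil E F V E' F' /\
    forall z : option R[i],
      eigen_mult E' F' z = if in_open_disk z then eigen_mult E F z else 0%N.

Definition expi (t : R) : R[i] := cos t +i* sin t.

(* The integral of f over the positively oriented unit circle, parametrized by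
   z = e^(it), dz = i e^(it) dt, 0 <= t <= 2 pi. *)
Definition circle_integral (f : R[i] -> R[i]) : R[i] :=
  let g t := f (expi t) * ((0 +i* 1) * expi t) in
  Rintegral lebesgue_measure `[0, 2 * pi]%classic (fun t : R => complex.Re (g t)) +i*
  Rintegral lebesgue_measure `[0, 2 * pi]%classic (fun t : R => complex.Im (g t)).

Definition contour_matrix M : 'M[R[i]]_N :=
  \matrix_(i, j) (((2 * pi)%:C * (0 +i* 1))^-1 *
    circle_integral (fun z => invmx (pencil M M^T z) i j)).

End ComplexPencil.

Definition block_matrix (R : realType) (n : nat) (A B C D : 'M[R]_n) :
    'M[R[i]]_(n + n) :=
  map_mx (real_complex R) (block_mx C D A (- B)).

(* Main.v *)
(* For any pencil E + zF without eigenvalues on the unit circle, a generalised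
   Schur form separates the eigenvalues in the open disk: with invertible P, Q,
   E + zF = P [E1 + zF1, E3 + zF3; 0, E2 + zF2] Q, where E1 + zF1 carries the
   eigenvalues inside the disk and F1 is invertible.  Write
   C = (1/2 pi i) * (contour integral of (E + zF)^-1), let X be the first columns
   of Q^-1 and Y those of P.  Then (E + zF) X = Y (E1 + zF1) gives C Y = X C1,
   with C1 F1 = 1 since E1 + zF1 is invertible outside the disk.  Dually, the last
   rows of Q annihilate C, because the integral of (E2 + zF2)^-1 vanishes.
   Hence C F X = X and C = X Z, so that C and C F have the range of X and C F is
   idempotent.  Applied to any other stable deflating subspace S, the first
   identity gives S <= range C, and counting eigenvalues gives equality. *)
Require Import Defs.
From mathcomp Require Import all_boot all_order all_algebra.
From mathcomp Require Import perm complex ring lra.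
From mathcomp Require Import all_classical all_reals all_analysis.

Set Implicit Arguments.
Unset Strict Implicit.
Unset Printing Implicit Defensive.

Import Order.TTheory GRing.Theory Num.Theory numFieldNormedType.Exports.
Local Open Scope ring_scope.

(** * Means over the unit circle *)

Section Mean.
Local Open Scope complex_scope.
Variable R : realType.
Implicit Types (f g : R -> R) (h : R -> R[i]) (t w : R) (p q : {poly R[i]}).

Let Re := @complex.Re R.
Let Im := @complex.Im R.

Lemma complex_eqP (x y : R[i]) : Re x = Re y -> Im x = Im y -> x = y.
Proof. by case: x => a b; case: y => c d /= -> ->. Qed.

Definition ccontinuous h : Prop :=
  continuous (fun t => Re (h t)) /\ continuous (fun t => Im (h t)).

Definition turn_integral f : R :=
  Rintegral lebesgue_measure `[0, 2 * pi]%classic f.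

(** For [h t] = z f(z) with z = [expi t], this is 1/(2 pi i) times the integral of f over the
    circle, because dz = i z dt. *)
Definition mean h : R[i] :=
  (2 * pi)^-1%:C *
  (turn_integral (fun t => Re (h t)) +i* turn_integral (fun t => Im (h t))).

Lemma turn_integrable f : continuous f ->
  lebesgue_measure.-integrable `[0, 2 * pi]%classic (EFin \o f).
Proof.
move=> cf; apply: continuous_compact_integrable; first exact: segment_compact.
exact: continuous_subspaceT.
Qed.

Lemma turn_integralD f g : continuous f -> continuous g ->
  turn_integral (fun t => f t + g t) = turn_integral f + turn_integral g.
Proof.
by move=> cf cg; apply: RintegralD => //; apply: turn_integrable.
Qed.

Lemma turn_integralZ (a : R) f : continuous f ->
  turn_integral (fun t => a * f t) = a * turn_integral f.
Proof. by move=> cf; apply: RintegralZl => //; apply: turn_integrable. Qed.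

Lemma turn_integral_cst (a : R) : turn_integral (fun=> a) = a * (2 * pi).
Proof.
rewrite /turn_integral Rintegral_cst//; congr (_ * _).
have := lebesgue_measure_itv `[0, 2 * pi : R]%R.
by rewrite /= lte_fin mulr_gt0 ?pi_gt0// => ->; rewrite /= subr0.
Qed.

Lemma turn_integral_bound f (K : R) : continuous f ->
  (forall t, 0 <= t <= 2 * pi -> `|f t| <= K) ->
  `|turn_integral f| <= K * (2 * pi).
Proof.
move=> cf fK; apply: (le_trans (le_normr_Rintegral _ _)) => //.
  exact: turn_integrable.
rewrite -turn_integral_cst.
apply: le_Rintegral => //.
- by apply: turn_integrable => t; apply: continuous_comp; [exact: cf|exact: norm_continuous].
- by apply: turn_integrable => t; exact: cst_continuous.
Qed.

Lemma fcontinuousD f g : continuous f -> continuous g ->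
  continuous (fun t => f t + g t).
Proof. by move=> cf cg t; exact: (@continuousD _ _ _ f g t (cf t) (cg t)). Qed.

Lemma fcontinuousM f g : continuous f -> continuous g ->
  continuous (fun t => f t * g t).
Proof. by move=> cf cg t; exact: (@continuousM _ _ f g t (cf t) (cg t)). Qed.

Lemma fcontinuousN f : continuous f -> continuous (fun t => - f t).
Proof. by move=> cf t; exact: (@continuousN _ _ _ f t (cf t)). Qed.

Lemma ccontinuousD h1 h2 : ccontinuous h1 -> ccontinuous h2 ->
  ccontinuous (fun t => h1 t + h2 t).
Proof.
move=> [r1 i1] [r2 i2]; split.
  have -> : (fun t => Re (h1 t + h2 t)) = (fun t => Re (h1 t) + Re (h2 t)).
    by apply/funext => t; exact: raddfD.
  exact: fcontinuousD.
have -> : (fun t => Im (h1 t + h2 t)) = (fun t => Im (h1 t) + Im (h2 t)).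
  by apply/funext => t; exact: raddfD.
exact: fcontinuousD.
Qed.

Lemma ReM (x y : R[i]) : Re (x * y) = Re x * Re y - Im x * Im y.
Proof. by case: x => a b; case: y => c d. Qed.

Lemma ImM (x y : R[i]) : Im (x * y) = Re x * Im y + Im x * Re y.
Proof. by case: x => a b; case: y => c d. Qed.

Lemma ccontinuousM h1 h2 : ccontinuous h1 -> ccontinuous h2 ->
  ccontinuous (fun t => h1 t * h2 t).
Proof.
move=> [r1 i1] [r2 i2]; split.
  under eq_fun do rewrite ReM.
  by apply: fcontinuousD; [|apply: fcontinuousN]; exact: fcontinuousM.
under eq_fun do rewrite ImM.
by apply: fcontinuousD; exact: fcontinuousM.
Qed.

Lemma ccontinuous_cst (c : R[i]) : ccontinuous (fun=> c).
Proof. by split=> t; exact: cst_continuous. Qed.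

Lemma ccontinuousV h : (forall t, h t != 0) -> ccontinuous h ->
  ccontinuous (fun t => (h t)^-1).
Proof.
move=> h0 [rc ic].
have ReV x : Re x^-1 = Re x * (Re x ^+ 2 + Im x ^+ 2)^-1 by case: x.
have ImV x : Im x^-1 = - (Im x * (Re x ^+ 2 + Im x ^+ 2)^-1) by case: x.
have n0 t : Re (h t) ^+ 2 + Im (h t) ^+ 2 != 0.
  rewrite paddr_eq0 ?sqr_ge0// !sqrf_eq0; apply: contra (h0 t) => /andP[/eqP a /eqP b].
  by apply/eqP/complex_eqP.
have nc : continuous (fun t => (Re (h t) ^+ 2 + Im (h t) ^+ 2)^-1).
  move=> t; apply: (@continuousV _ _ (fun t => Re (h t) ^+ 2 + Im (h t) ^+ 2)).
    exact: n0.
  by move: t; apply: fcontinuousD; exact: fcontinuousM.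
split; first under eq_fun do rewrite ReV; last under eq_fun do rewrite ImV.
  exact: fcontinuousM.
by apply: fcontinuousN; exact: fcontinuousM.
Qed.

Lemma ccontinuous_sum (I : Type) (s : seq I) (h : I -> R -> R[i]) :
  (forall i, ccontinuous (h i)) -> ccontinuous (fun t => \sum_(i <- s) h i t).
Proof.
move=> ch; elim: s => [|i s IH].
  by under eq_fun do rewrite big_nil; exact: ccontinuous_cst.
by under eq_fun do rewrite big_cons; exact: ccontinuousD.
Qed.

Lemma ccontinuous_horner h p : ccontinuous h -> ccontinuous (fun t => p.[h t]).
Proof.
move=> ch; elim/poly_ind: p => [|p c IH].
  by under eq_fun do rewrite horner0; exact: ccontinuous_cst.
under eq_fun do rewrite hornerMXaddC.
by apply: ccontinuousD; [exact: ccontinuousM|exact: ccontinuous_cst].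
Qed.

Lemma meanD h1 h2 : ccontinuous h1 -> ccontinuous h2 ->
  mean (fun t => h1 t + h2 t) = mean h1 + mean h2.
Proof.
move=> [r1 i1] [r2 i2]; rewrite /mean -mulrDr; congr (_ * _).
have -> : (fun t => Re (h1 t + h2 t)) = (fun t => Re (h1 t) + Re (h2 t)).
  by apply/funext => t; exact: raddfD.
have -> : (fun t => Im (h1 t + h2 t)) = (fun t => Im (h1 t) + Im (h2 t)).
  by apply/funext => t; exact: raddfD.
by rewrite !turn_integralD.
Qed.

Lemma meanZ (c : R[i]) h : ccontinuous h ->
  mean (fun t => c * h t) = c * mean h.
Proof.
move=> [rc ic]; rewrite /mean mulrCA; congr (_ * _).
under [X in turn_integral X +i* _]eq_fun do rewrite ReM -mulNr.
under [X in _ +i* turn_integral X]eq_fun do rewrite ImM.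
rewrite !turn_integralD ?turn_integralZ//; do ?by
  apply: fcontinuousM => // t; exact: cst_continuous.
by apply: complex_eqP; rewrite ?ReM ?ImM/= ?mulNr.
Qed.

Lemma mean_cst (c : R[i]) : mean (fun=> c) = c.
Proof.
have tw : (2 * pi : R) != 0 by rewrite mulf_neq0 ?gt_eqF ?pi_gt0.
rewrite /mean !turn_integral_cst; apply: complex_eqP; rewrite ?ReM ?ImM/= ?mul0r ?subr0 ?addr0.
  by rewrite mulrCA mulVf ?mulr1.
by rewrite mulrCA mulVf ?mulr1.
Qed.

Lemma mean_sum (I : Type) (s : seq I) (h : I -> R -> R[i]) :
  (forall i, ccontinuous (h i)) ->
  mean (fun t => \sum_(i <- s) h i t) = \sum_(i <- s) mean (h i).
Proof.
move=> ch; elim: s => [|i s IH].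
  by under eq_fun do rewrite big_nil; rewrite big_nil mean_cst.
under eq_fun do rewrite big_cons.
by rewrite meanD ?IH ?big_cons//; exact: ccontinuous_sum.
Qed.

(** The bound is uniform in [e]: with the powers of z for [e], it controls the means of all z^m h at
    once. *)
Lemma mean_bounded h : ccontinuous h -> exists K : R, forall (e : R -> R[i]),
  ccontinuous e -> (forall t, `|e t| = 1) ->
  `|mean (fun t => e t * h t)| <= K%:C.
Proof.
move=> [rc ic].
have tw : (0 : R) < 2 * pi by rewrite mulr_gt0 ?pi_gt0.
have [a _ Ka] : exists2 a : R, a \in `[0, 2 * pi] &
    forall t, t \in `[0, 2 * pi] -> `|Re (h t)| + `|Im (h t)| <= `|Re (h a)| + `|Im (h a)|.
  apply: (@EVT_max _ (fun t => `|Re (h t)| + `|Im (h t)|)); first exact: ltW.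
  apply: continuous_subspaceT; apply: fcontinuousD => t.
    by apply: continuous_comp; [exact: rc|exact: norm_continuous].
  by apply: continuous_comp; [exact: ic|exact: norm_continuous].
(* [K] bounds the modulus of [e t * h t], hence the real and the imaginary part of the mean
   separately; the modulus of the mean is at most their sum. *)
set K := _ + _ in Ka; exists (K + K) => e ce e1.
have leN (z : R[i]) : `|Re z|%:C <= `|z| /\ `|Im z|%:C <= `|z|.
  split; first exact: normc_ge_Re.
  have := normc_ge_Re (z * 'i); rewrite ReiNIm normrN normrM.
  suff -> : `|'i| = 1 :> R[i] by rewrite mulr1.
  by rewrite normc_def/= expr0n expr1n/= add0r sqrtr1.
have Nle (z : R[i]) : `|z| <= (`|Re z| + `|Im z|)%:C.
  rewrite [z in `|z|]complexE (le_trans (ler_normD _ _))// normrM.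
  have -> : `|'i| = 1 :> R[i] by rewrite normc_def/= expr0n expr1n/= add0r sqrtr1.
  rewrite mul1r !normc_def/= !expr0n !addr0 !sqrtr_sqr -rmorphD//.
have eh t : 0 <= t <= 2 * pi -> `|e t * h t| <= K%:C.
  by move=> ht; rewrite normrM e1 mul1r (le_trans (Nle _))// lecR Ka.
have [reh ieh] := ccontinuousM ce (conj rc ic).
rewrite normrM (le_trans (ler_wpM2l _ (Nle _)))//=.
rewrite normc_def/= expr0n/= addr0 sqrtr_sqr -rmorphM lecR.
rewrite ger0_norm ?invr_ge0 ?(ltW tw)// ler_pdivrMl// mulrDr lerD//.
  rewrite mulrC; apply: turn_integral_bound => // t ht.
  by rewrite -lecR (le_trans _ (eh _ ht))//; case: (leN (e t * h t)).
rewrite mulrC; apply: turn_integral_bound => // t ht.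
by rewrite -lecR (le_trans _ (eh _ ht))//; case: (leN (e t * h t)).
Qed.

Lemma expiD t u : expi (t + u) = expi t * expi u.
Proof. by rewrite /expi cosD sinD; apply: complex_eqP; rewrite ?ReM ?ImM/= // addrC. Qed.

Lemma expi0 : expi 0 = 1 :> R[i].
Proof. by rewrite /expi cos0 sin0. Qed.

Lemma expiX t k : expi t ^+ k = expi (k%:R * t).
Proof.
elim: k => [|k IH]; first by rewrite mul0r expi0.
by rewrite exprS IH -expiD -natr1 mulrDl mul1r addrC.
Qed.

Lemma norm_expi t : `|expi t| = 1.
Proof. by rewrite normc_def/= cos2Dsin2 sqrtr1. Qed.

Lemma ccontinuous_expi w : ccontinuous (fun t => expi (w * t)).
Proof.
have c : continuous (fun t => w * t).
  by apply: fcontinuousM => t; [exact: cst_continuous|exact: cvg_id].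
split=> t; apply: (@continuous_comp _ _ _ (fun t => w * t)); do ?[exact: c].
  exact: continuous_cos.
exact: continuous_sin.
Qed.

(** The antiderivatives sin(wt)/w and -cos(wt)/w take equal values at 0 and 2 pi. The condition on
    [w] covers frequencies of both signs, as needed for the reversed circle. *)
Lemma mean_expi w : w != 0 -> expi (w * (2 * pi)) = 1 ->
  mean (fun t => expi (w * t)) = 0.
Proof.
move=> w0 [cw sw].
have tw : (0 : R) < 2 * pi by rewrite mulr_gt0 ?pi_gt0.
have FTC (f F : R -> R) : continuous f -> (forall t, is_derive t 1 F (f t)) ->
    F (2 * pi) = F 0 -> turn_integral f = 0.
  move=> cf dF F2; rewrite /turn_integral /Rintegral (@continuous_FTC2 _ f F)//.
  - by rewrite F2 -EFinB subrr.
  - exact: continuous_subspaceT.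
  - have cF t : {for t, continuous F}.
      by apply: differentiable_continuous; apply/derivable1_diffP; case: (dF t).
    split=> [t _||]; first by case: (dF t).
      by apply: cvg_at_right_filter; exact: cF.
    by apply: cvg_at_left_filter; exact: cF.
  - by move=> t _; rewrite derive1E; case: (dF t).
have [cc cs] := ccontinuous_expi w.
have is1 t : is_derive t 1 (fun t => w * t) w.
  by apply: is_derive_eq; rewrite /GRing.scale/= mulr1.
have Rint : turn_integral (fun t => Re (expi (w * t))) = 0.
  apply: (FTC _ (fun t => w^-1 * sin (w * t))) => //.
    move=> t; have ds := is_derive1_comp (is_derive_sin (w * t)) (is1 t).
    by apply: is_derive_eq; rewrite /GRing.scale/=; field.
  by rewrite mulr0 sin0 sw.
have Iint : turn_integral (fun t => Im (expi (w * t))) = 0.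
  apply: (FTC _ (fun t => - w^-1 * cos (w * t))) => //.
    move=> t; have ds := is_derive1_comp (is_derive_cos (w * t)) (is1 t).
    by apply: is_derive_eq; rewrite /GRing.scale/=; field.
  by rewrite mulr0 cos0 cw.
by rewrite /mean Rint Iint mulr0.
Qed.

End Mean.

(** * Vanishing means of rational functions without poles in the closed disk *)

Section MeanValue.
Local Open Scope complex_scope.
Variable R : realType.
Implicit Types (h : R -> R[i]) (t w : R) (p q r : {poly R[i]}).

Lemma bernoulli_le (d : R) m : 0 <= d -> 1 + m%:R * d <= (1 + d) ^+ m.
Proof.
move=> d0; elim: m => [|m IH]; first by rewrite mul0r addr0.
rewrite exprS (le_trans _ (ler_wpM2l _ IH))//; last by rewrite addr_ge0.
rewrite -natr1; have : 0 <= m%:R * d * d by rewrite !mulr_ge0.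
lra.
Qed.

(** By Bernoulli's inequality |a|^m |x| grows at least linearly in m when x is nonzero, so by the
    Archimedean property it passes every bound. *)
Lemma bounded_powers_eq0 (a x : R[i]) (K : R) : 1 < `|a| ->
  (forall m, `|a ^+ m * x| <= K%:C) -> x = 0.
Proof.
move=> a1 xK; apply/eqP/negPn/negP => x0.
have nE (z : R[i]) : `|z| = (complex.Re `|z|)%:C by rewrite normc_def.
move: a1; rewrite nE; set b := complex.Re _ => a1.
have {}a1 : 1 < b by rewrite -ltcR.
have y0 : 0 < complex.Re `|x| by rewrite -ltcR -nE normr_gt0.
set y := complex.Re _ in y0.
have bK m : b ^+ m * y <= K.
  by have := xK m; rewrite normrM normrX (nE a) (nE x) -rmorphXn -rmorphM lecR.
have e0 : 0 < (b - 1) * y by rewrite mulr_gt0// subr_gt0.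
have := archi_boundP (normr_ge0 (K / ((b - 1) * y))).
set k := Num.bound _ => hk.
have : K < k%:R * ((b - 1) * y).
  by rewrite -ltr_pdivrMr// (le_lt_trans (ler_norm _)).
have hb : 1 + k%:R * (b - 1) <= b ^+ k.
  have b1 : 1 + (b - 1) = b by ring.
  by rewrite -[X in _ <= X ^+ _]b1 bernoulli_le// subr_ge0 ltW.
have := bK k; have := ler_wpM2r (ltW y0) hb.
rewrite mulrDl mul1r mulrA; lra.
Qed.

(* With J q the mean of z q(z) / r(z) and a root of r, cancelling a factor
   gives J (X q) = a J q; the J (X^m q) are bounded and |a| > 1. *)
Lemma mean_rational w p q : w != 0 -> expi (w * (2 * pi)) = 1 ->
  (forall z, `|z| <= 1 -> p.[z] != 0) ->
  mean (fun t => expi (w * t) * (q.[expi (w * t)] / p.[expi (w * t)])) = 0.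
Proof.
move=> w0 w1 p0; pose e t := expi (w * t).
have ce : ccontinuous e by exact: ccontinuous_expi.
have e1 t : `|e t| = 1 by exact: norm_expi.
have eX k : mean (fun t => e t ^+ k.+1) = 0.
  rewrite /e; under eq_fun do rewrite expiX mulrA.
  apply: mean_expi; first by rewrite mulf_neq0 ?pnatr_eq0.
  by rewrite -mulrA -expiX w1 expr1n.
have [s sE] := closed_field_poly_normal p.
have lp : lead_coef p != 0.
  by rewrite lead_coef_eq0; apply: contraNneq (p0 0 _) => [->|]; rewrite ?horner0 ?normr0.
have s1 a : a \in s -> 1 < `|a|.
  move=> sa; rewrite real_ltNge ?normr_real//; apply/negP => /p0/negP; apply.
  by rewrite -/(root p a) sE rootZ// root_prod_XsubC.
have cX k : ccontinuous (fun t => e t ^+ k).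
  have -> : (fun t => e t ^+ k) = (fun t => ('X^k : {poly R[i]}).[e t]).
    by apply/funext => t; rewrite hornerXn.
  exact: ccontinuous_horner.
(* The leading coefficient of [p] goes into the numerator. The numerator stays arbitrary in the
   induction on the roots, since [JX] uses the hypothesis for every [q0]. *)
suff main q' : mean (fun t => e t * (q'.[e t] / (\prod_(a <- s) ('X - a%:P)).[e t])) = 0.
  rewrite -[RHS](main ((lead_coef p)^-1 *: q)); congr mean; apply/funext => t.
  by rewrite {1}sE !hornerZ invfM -/(e t); ring.
elim: s s1 {sE} q' => [|a s IH] s1 q'.
  under eq_fun do rewrite big_nil hornerC divr1.
  (* Without poles left, z times a polynomial has only positive powers of z; letting the exponent
     vary makes the induction on Horner's form close. *)
  suff gen k q0 : mean (fun t => e t ^+ k.+1 * q0.[e t]) = 0.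
    exact: (gen 0%N q').
  elim/poly_ind: q0 k => [|q0 c IHq] k.
    by under eq_fun do rewrite horner0 mulr0; rewrite mean_cst.
  under eq_fun do rewrite hornerMXaddC mulrDr [_ * e _]mulrC mulrA -exprSr [_ * c]mulrC.
  rewrite meanD ?meanZ ?eX ?IHq ?mulr0 ?addr0//.
    by apply: ccontinuousM => //; exact: ccontinuous_horner.
  by apply: ccontinuousM => //; exact: ccontinuous_cst.
set P := \prod_(b <- _) _.
have Pe t : P.[e t] != 0.
  rewrite -/(root P (e t)) root_prod_XsubC; apply/negP => /s1.
  by rewrite e1 ltxx.
have cP : ccontinuous (fun t => P.[e t]^-1).
  by apply: ccontinuousV => //; exact: ccontinuous_horner.
have cJ q0 : ccontinuous (fun t => e t * (q0.[e t] / P.[e t])).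
  by apply: ccontinuousM => //; apply: ccontinuousM => //; exact: ccontinuous_horner.
pose J q0 := mean (fun t => e t * (q0.[e t] / P.[e t])).
have s1' b : b \in s -> 1 < `|b| by move=> sb; apply: s1; rewrite in_cons sb orbT.
have JX q0 : J ('X * q0) = a * J q0.
  apply/eqP; rewrite -subr_eq0; apply/eqP.
  rewrite -mulNr -meanZ// -meanD//; last by apply: ccontinuousM => //; exact: ccontinuous_cst.
  rewrite -[RHS](IH s1' q0); congr mean; apply/funext => t.
  have := Pe t; have -> : P.[e t] = (e t - a) * (\prod_(b <- s) ('X - b%:P)).[e t].
    by rewrite /P big_cons hornerM hornerXsubC.
  rewrite hornerM hornerX mulf_eq0 negb_or => /andP[n1 n2].
  by field; rewrite n1 n2.
have JXm q0 m : J ('X^m * q0) = a ^+ m * J q0.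
  by elim: m => [|m IHm]; rewrite ?expr0 ?mul1r// exprS -mulrA JX IHm exprS mulrA.
have [K hK] := mean_bounded (cJ q').
apply: (@bounded_powers_eq0 a _ K) => [|m]; first by apply: s1; rewrite mem_head.
rewrite -/(J q') -JXm (le_trans _ (hK (fun t => e t ^+ m) _ _))//.
  rewrite /J le_eqVlt; apply/orP; left; apply/eqP; congr (`|mean _|); apply/funext => t.
  by rewrite hornerM hornerXn; ring.
by move=> t; rewrite normrX e1 expr1n.
Qed.

End MeanValue.

(** * Contour integrals of resolvents *)

Section PencilAlgebra.
Variables (K : fieldType) (N : nat).
Implicit Types (E F : 'M[K]_N).

Lemma horner_pencil_poly E F z : (pencil_poly E F).[z] = \det (pencil E F z).
Proof.
rewrite /pencil_poly -horner_evalE -det_map_mx; congr (\det _).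
apply/matrixP => i j; rewrite !mxE /= horner_evalE.
by rewrite hornerD hornerM hornerX !hornerC.
Qed.

(** Cramer's rule: the entries of the resolvent are rational functions of z with common denominator
    det(E + zF), which brings them within reach of [mean_rational]. *)
Lemma invmx_pencil E F z i j : \det (pencil E F z) != 0 ->
  invmx (pencil E F z) i j =
  (\adj (map_mx polyC E + 'X *: map_mx polyC F) i j).[z] / (pencil_poly E F).[z].
Proof.
move=> d0; rewrite /invmx unitmxE unitfE d0 mxE mulrC horner_pencil_poly.
congr (_ / _); rewrite -horner_evalE -[RHS](mxE tt (fun i j => horner_eval z (\adj _ i j))).
have -> : pencil E F z =
    map_mx (horner_eval z) (map_mx polyC E + 'X *: map_mx polyC F).
  apply/matrixP => k l; rewrite !mxE /= horner_evalE.
  by rewrite hornerD hornerM hornerX !hornerC.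
by rewrite -map_mx_adj !mxE.
Qed.

Lemma regular_pencilP E F z : \det (pencil E F z) != 0 -> regular_pencil E F.
Proof.
by rewrite -horner_pencil_poly; apply: contraNneq => ->; rewrite horner0.
Qed.

End PencilAlgebra.

Section Contour.
Local Open Scope complex_scope.
Variable R : realType.

Definition mxmean m n (f : R -> 'M[R[i]]_(m, n)) : 'M[R[i]]_(m, n) :=
  \matrix_(i, j) mean (fun t => f t i j).

Definition mxcontinuous m n (f : R -> 'M[R[i]]_(m, n)) : Prop :=
  forall i j, ccontinuous (fun t => f t i j).

Lemma mxmean_mull m n p (A : 'M[R[i]]_(m, n)) (f : R -> 'M[R[i]]_(n, p)) :
  mxcontinuous f -> mxmean (fun t => A *m f t) = A *m mxmean f.
Proof.
move=> cf; apply/matrixP => i j; rewrite !mxE.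
under eq_fun do rewrite mxE.
rewrite mean_sum => [|k]; last by apply: ccontinuousM => //; exact: ccontinuous_cst.
by apply: eq_bigr => k _; rewrite meanZ// mxE.
Qed.

Lemma mxmean_mulr m n p (A : 'M[R[i]]_(n, p)) (f : R -> 'M[R[i]]_(m, n)) :
  mxcontinuous f -> mxmean (fun t => f t *m A) = mxmean f *m A.
Proof.
move=> cf; apply/matrixP => i j; rewrite !mxE.
under eq_fun do rewrite mxE.
rewrite mean_sum => [|k]; last by apply: ccontinuousM => //; exact: ccontinuous_cst.
by apply: eq_bigr => k _; under eq_fun do rewrite mulrC; rewrite meanZ// mxE mulrC.
Qed.

(* For w = -1 the circle is run through backwards, which is the substitution
   z -> 1/z that exchanges E + zF with its reversal F + zE. *)
Definition resolvent N (E F : 'M[R[i]]_N) w t : 'M[R[i]]_N :=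
  expi (w * t) *: invmx (pencil E F (expi (w * t))).

Definition contour N (E F : 'M[R[i]]_N) : 'M[R[i]]_N := mxmean (resolvent E F 1).

Lemma resolvent_continuous N (E F : 'M[R[i]]_N) w :
  non_critical E F -> mxcontinuous (resolvent E F w).
Proof.
move=> nc i j; have ce := ccontinuous_expi w.
have d0 t : \det (pencil E F (expi (w * t))) != 0 by apply: nc; exact: norm_expi.
under eq_fun do rewrite mxE invmx_pencil//.
apply: ccontinuousM => //; apply: ccontinuousM; first exact: ccontinuous_horner.
apply: ccontinuousV; last exact: ccontinuous_horner.
by move=> t; rewrite horner_pencil_poly.
Qed.

(** The integrand is i [h t], so its real part is - Im h and its imaginary part Re h; the factor i
    then cancels against 1/(2 pi i). *)
Lemma circle_integralE (f : R[i] -> R[i]) :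
  ccontinuous (fun t => expi t * f (expi t)) ->
  ((2 * pi)%:C * (0 +i* 1))^-1 * circle_integral f =
  mean (fun t => expi t * f (expi t)).
Proof.
move=> [cr ci]; pose h t := expi t * f (expi t).
have gE t : f (expi t) * ((0 +i* 1) * expi t) =
    - complex.Im (h t) +i* complex.Re (h t).
  by rewrite /h; case: (f _) => a b; case: (expi t) => c d; apply: complex_eqP => /=; ring.
have -> : circle_integral f =
    turn_integral (fun t => -1 * complex.Im (h t)) +i* turn_integral (fun t => complex.Re (h t)).
  rewrite /circle_integral /turn_integral; congr (_ +i* _);
    by apply: eq_Rintegral => t _; rewrite gE /= ?mulN1r.
rewrite turn_integralZ// /mean invfM fmorphV -mulrA; congr (_ * _).
have i0 : (0 +i* 1 : R[i]) != 0 by rewrite eq_complex /= oner_eq0 andbF.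
by apply: (mulfI i0); rewrite mulrA divff// mul1r; apply: complex_eqP => /=; ring.
Qed.

Lemma contour_matrixE N (M : 'M[R[i]]_N) : non_critical M M^T ->
  contour_matrix M = contour M M^T.
Proof.
move=> nc; apply/matrixP => i j; have := resolvent_continuous 1 nc i j.
rewrite /resolvent; under eq_fun do rewrite mxE mul1r.
move=> cr; rewrite !mxE circle_integralE//.
by congr mean; apply/funext => t; rewrite mxE mul1r.
Qed.

(** Cauchy's theorem for the resolvent, entry by entry through Cramer's rule. It is used with [w] =
    1 and, for the reversed pencil, with [w] = -1. *)
Lemma contour_analytic N (E F : 'M[R[i]]_N) w : w != 0 -> expi (w * (2 * pi)) = 1 ->
  (forall z, `|z| <= 1 -> \det (pencil E F z) != 0) ->
  mxmean (resolvent E F w) = 0.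
Proof.
move=> w0 w1 nd; apply/matrixP => i j; rewrite !mxE.
under eq_fun do rewrite mxE invmx_pencil ?nd ?norm_expi//.
by apply: mean_rational => // z /nd; rewrite horner_pencil_poly.
Qed.

(* z (E + zF)^-1 F = 1 - (F + z^-1 E)^-1 z^-1 E, and the mean of the last term
   vanishes since F + zE is invertible on the closed disk. *)
Lemma contour_stable N (E F : 'M[R[i]]_N) : F \in unitmx ->
  (forall z, 1 <= `|z| -> \det (pencil E F z) != 0) ->
  contour E F *m F = 1%:M.
Proof.
move=> uF nd; have nc : non_critical E F by move=> z z1; rewrite nd ?z1.
have eN t : expi (1 * t) * expi (-1 * t) = 1 :> R[i].
  by rewrite -expiD mul1r mulN1r subrr expi0.
have e0 t : expi t != 0 :> R[i] by rewrite -normr_gt0 norm_expi.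
have penV z : z != 0 -> pencil E F z = z *: pencil F E z^-1.
  by move=> z0; rewrite /pencil scalerDr scalerA divff// scale1r addrC.
(* At z = 0 the reversed pencil is [F], which is invertible; elsewhere it is z (E + z^-1 F) with
   |z^-1| >= 1. *)
have ndV z : `|z| <= 1 -> \det (pencil F E z) != 0.
  have [->|z0] := eqVneq z 0.
    by move=> _; rewrite /pencil scale0r addr0 -unitfE -unitmxE.
  move=> z1; have := nd z^-1; rewrite normrV ?unitfE// invf_ge1 ?normr_gt0//.
  move=> /(_ z1); rewrite penV ?invr_eq0// invrK detZ mulf_eq0 negb_or.
  by case/andP.
have ncV : non_critical F E by move=> z z1; rewrite ndV ?z1.
have N1 : expi (-1 * (2 * pi)) = 1 :> R[i].
  by rewrite mulN1r /expi cosN sinN mulrC mulr_natr cos2pi sin2pi oppr0.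
have key t : resolvent E F 1 t *m F = 1%:M - resolvent F E (-1) t *m E.
  have vE : expi (-1 * t) = (expi (1 * t))^-1 :> R[i].
    by rewrite -[RHS]mulr1 -(eN t) mulKf.
  rewrite /resolvent vE; set z := expi (1 * t).
  have z0 : z != 0 by exact: e0.
  have u : pencil F E z^-1 \in unitmx.
    by rewrite unitmxE unitfE ndV// normrV ?unitfE// norm_expi invr1.
  rewrite penV// invmxZ ?scalerA ?divff//; last first.
    by rewrite -[z *: _]mul_scalar_mx unitmx_mul u andbT unitmxE det_scalar unitfE expf_neq0.
  rewrite scale1r; apply: (can_inj (mulKmx u)).
  rewrite mulmxA mulmxV// mul1mx mulmxBr mulmx1 mulmxA -scalemxAr mulmxV//.
  by rewrite -scalemxAl mul1mx /pencil addrK.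
have c1 := resolvent_continuous 1 nc; have c2 := resolvent_continuous (-1) ncV.
rewrite -mxmean_mulr//; under eq_fun do rewrite key.
have m0 : mxmean (resolvent F E (-1)) *m E = 0.
  by rewrite contour_analytic ?mul0mx// oppr_eq0 oner_eq0.
rewrite -[RHS]subr0 -m0 -mxmean_mulr//; apply/matrixP => i j; rewrite [LHS]mxE.
have -> : (fun t => (1%:M - resolvent F E (-1) t *m E) i j) =
   (fun t => (1%:M : 'M[R[i]]_N) i j + (-1) * (resolvent F E (-1) t *m E) i j).
  by apply/funext => t; rewrite !mxE mulN1r.
have ccE : ccontinuous (fun t => (resolvent F E (-1) t *m E) i j).
  under eq_fun do rewrite mxE.
  by apply: ccontinuous_sum => k; apply: ccontinuousM => //; exact: ccontinuous_cst.
rewrite meanD ?meanZ ?mean_cst ?mulN1r//; first by rewrite !mxE.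
  exact: ccontinuous_cst.
by apply: ccontinuousM => //; exact: ccontinuous_cst.
Qed.

(** Both pencils are invertible on the circle, so (E + zF) X = Y (E1 + zF1) turns into (E + zF)^-1 Y
    = X (E1 + zF1)^-1 pointwise, and the constant factors leave the mean. *)
Lemma contour_intertwine N k (E F : 'M[R[i]]_N) (E1 F1 : 'M[R[i]]_k)
    (X Y : 'M[R[i]]_(N, k)) :
  non_critical E F -> non_critical E1 F1 ->
  E *m X = Y *m E1 -> F *m X = Y *m F1 ->
  contour E F *m Y = X *m contour E1 F1.
Proof.
move=> nc nc1 eE eF.
rewrite -mxmean_mulr -?mxmean_mull//; do ?exact: resolvent_continuous.
congr mxmean; apply/funext => t; rewrite /resolvent -scalemxAl -scalemxAr.
have z1 := norm_expi (1 * t); move: (expi _) z1 => z z1.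
have u : pencil E F z \in unitmx by rewrite unitmxE unitfE nc.
have u1 : pencil E1 F1 z \in unitmx by rewrite unitmxE unitfE nc1.
congr (_ *: _); apply: (can_inj (mulKmx u)); rewrite mulKVmx//.
apply: (can_inj (mulmxK u1)); rewrite -!mulmxA mulVmx// mulmx1.
by rewrite /pencil mulmxDl mulmxDr -scalemxAl -scalemxAr eE eF.
Qed.

Lemma contour_intertwine_l N k (E F : 'M[R[i]]_N) (E2 F2 : 'M[R[i]]_k)
    (L L' : 'M[R[i]]_(k, N)) :
  non_critical E F -> non_critical E2 F2 ->
  L' *m E = E2 *m L -> L' *m F = F2 *m L ->
  L *m contour E F = contour E2 F2 *m L'.
Proof.
move=> nc nc1 eE eF.
rewrite -mxmean_mulr -?mxmean_mull//; do ?exact: resolvent_continuous.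
congr mxmean; apply/funext => t; rewrite /resolvent -scalemxAl -scalemxAr.
have z1 := norm_expi (1 * t); move: (expi _) z1 => z z1.
have u : pencil E F z \in unitmx by rewrite unitmxE unitfE nc.
have u1 : pencil E2 F2 z \in unitmx by rewrite unitmxE unitfE nc1.
congr (_ *: _); apply: (can_inj (mulKmx u1)); rewrite mulKVmx//.
apply: (can_inj (mulmxK u)); rewrite -!mulmxA mulVmx// mulmx1.
by rewrite /pencil mulmxDl mulmxDr -scalemxAl -scalemxAr eE eF.
Qed.

End Contour.

(** * Characteristic polynomials and bases of columns *)

Section PencilPoly.
Variable K : fieldType.

Lemma pencil_poly_mul N (P Q E F : 'M[K]_N) :
  pencil_poly (P *m E *m Q) (P *m F *m Q) = (\det P * \det Q) *: pencil_poly E F.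
Proof.
rewrite /pencil_poly !map_mxM !scalemxAr -!mulmxA -mulmxDr -scalemxAr scalemxAl -mulmxDl.
by rewrite !det_mulmx !det_map_mx -mul_polyC rmorphM /=; ring.
Qed.

Lemma pencil_poly_block k m (E1 F1 : 'M[K]_k) (E2 F2 : 'M[K]_m) E3 F3 :
  pencil_poly (block_mx E1 E3 0 E2) (block_mx F1 F3 0 F2) =
  pencil_poly E1 F1 * pencil_poly E2 F2.
Proof.
rewrite /pencil_poly !map_block_mx scale_block_mx add_block_mx.
by rewrite !map_mx0 scaler0 addr0 det_ublock.
Qed.

(** Meant for the terms of the Leibniz expansion of det(E + XF); [a] and [b] become entries of E and
    F. *)
Lemma size_prod_linear_le (I : Type) (s : seq I) (a b : I -> K) :
  (size (\prod_(i <- s) ((a i)%:P + 'X * (b i)%:P))%R <= (size s).+1)%N /\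
  (\prod_(i <- s) ((a i)%:P + 'X * (b i)%:P))`_(size s) = \prod_(i <- s) b i.
Proof.
elim: s => [|i s [IHs IHc]]; first by rewrite !big_nil size_poly1 coefC eqxx.
rewrite !big_cons; set p := \prod_(_ <- _) _ in IHs IHc *.
have e : ((a i)%:P + 'X * (b i)%:P) * p = a i *: p + b i *: ('X * p).
  by rewrite -!mul_polyC; ring.
rewrite e; split.
  rewrite (leq_trans (size_polyD _ _))// geq_max; apply/andP; split.
    by rewrite (leq_trans (size_scale_leq _ _))// (leq_trans IHs).
  rewrite (leq_trans (size_scale_leq _ _))// (leq_trans (size_polyMleq _ _))//.
  by rewrite size_polyX.
rewrite coefD !coefZ coefXM /= IHc.
by rewrite nth_default// mulr0 add0r.
Qed.

Lemma pencil_polyE N (E F : 'M[K]_N) : pencil_poly E F =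
  \sum_(s : 'S_N) (-1) ^+ s *: \prod_(i <- enum 'I_N) ((E i (s i))%:P + 'X * (F i (s i))%:P).
Proof.
apply: eq_bigr => s _; rewrite -mul_polyC rmorph_sign big_enum; congr (_ * _).
by apply: eq_bigr => i _; rewrite !mxE.
Qed.

Lemma size_pencil_poly_le N (E F : 'M[K]_N) : (size (pencil_poly E F) <= N.+1)%N.
Proof.
rewrite pencil_polyE (leq_trans (size_sum _ _ _))//; apply/bigmax_leqP => s _.
rewrite (leq_trans (size_scale_leq _ _))//.
have [+ _] := size_prod_linear_le (enum 'I_N) (fun i => E i (s i)) (fun i => F i (s i)).
by rewrite size_enum_ord.
Qed.

(** Only the F part of each linear factor reaches degree N in the Leibniz expansion. Consequently
    det(E + zF) has full degree N, i.e. infinity is not an eigenvalue, exactly when F is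
    invertible. *)
Lemma coef_pencil_poly N (E F : 'M[K]_N) : (pencil_poly E F)`_N = \det F.
Proof.
rewrite pencil_polyE coef_sum; apply: eq_bigr => s _; rewrite coefZ; congr (_ * _).
have [_] := size_prod_linear_le (enum 'I_N) (fun i => E i (s i)) (fun i => F i (s i)).
by rewrite size_enum_ord [\prod_(i <- _) F i _]big_enum.
Qed.

Lemma size_pencil_poly N (E F : 'M[K]_N) :
  F \in unitmx -> size (pencil_poly E F) = N.+1.
Proof.
rewrite unitmxE unitfE -(coef_pencil_poly E) => c0.
apply/eqP; rewrite eqn_leq size_pencil_poly_le ltnNge; apply/negP => /leq_sizeP/(_ _ (leqnn _)) c.
by rewrite c eqxx in c0.
Qed.

Lemma unitmx_pencil N (E F : 'M[K]_N) :
  size (pencil_poly E F) = N.+1 -> F \in unitmx.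
Proof.
move=> sN; rewrite unitmxE unitfE -(coef_pencil_poly E) -[X in _`_X]/(N.+1.-1) -sN.
by rewrite -/(lead_coef _) lead_coef_eq0 -size_poly_eq0 sN.
Qed.

End PencilPoly.

Section Columns.
Variables (K : fieldType) (N : nat).

(** Rectangular version of [range_mx], convertible to it on square matrices. *)
Definition colspan k (X : 'M[K]_(N, k)) : {vspace 'cV[K]_N} :=
  limg (linfun (mulmx X : 'cV[K]_k -> 'cV[K]_N)).

Lemma colspanP k (X : 'M[K]_(N, k)) v :
  reflect (exists u : 'cV_k, v = X *m u) (v \in colspan X).
Proof.
apply: (iffP memv_imgP) => [[u _ ->]|[u ->]]; first by exists u; rewrite lfunE.
by exists u; rewrite ?memvf// lfunE.
Qed.

Lemma mulmx_sum_col k (X : 'M[K]_(N, k)) (u : 'cV_k) :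
  X *m u = \sum_j u j 0 *: col j X.
Proof.
apply/matrixP => i j; rewrite !mxE summxE; apply: eq_bigr => l _.
by rewrite !mxE (ord1 j) mulrC.
Qed.

Lemma columns_basisP k V (X : 'M[K]_(N, k)) :
  columns_basis V X <-> V = colspan X /\ (forall u : 'cV_k, X *m u = 0 -> u = 0).
Proof.
pose T := [tuple col j X | j < k].
have TE : [seq col j X | j <- enum 'I_k] = T by [].
have sumT (c : 'I_k -> K) : \sum_i c i *: T`_i = X *m \col_i c i.
  by rewrite mulmx_sum_col; apply: eq_bigr => i _; rewrite mxE -tnth_nth tnth_mktuple.
have spanT : <<T>>%VS = colspan X.
  apply/vspaceP => v; apply/idP/colspanP => [/coord_span ->|[u ->]].
    by rewrite sumT; eexists.
  rewrite mulmx_sum_col rpred_sum// => j _; rewrite rpredZ// memv_span//.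
  by apply/tnthP; exists j; rewrite tnth_mktuple.
rewrite /columns_basis TE; split=> [bV|[-> injX]].
  split; first by rewrite -(span_basis bV).
  move=> u Xu0; have /freeP fT := basis_free bV.
  apply/matrixP => i j; rewrite (ord1 j) [RHS]mxE; apply: (fT (fun i => u i 0)).
  by rewrite sumT -[RHS]Xu0; congr (_ *m _); apply/matrixP => a b; rewrite mxE (ord1 b).
rewrite /basis_of spanT eqxx; apply/freeP => c; rewrite sumT => /injX c0 i.
by have /matrixP/(_ i 0) := c0; rewrite !mxE.
Qed.

Lemma columns_basis_dim k V (X : 'M[K]_(N, k)) : columns_basis V X -> \dim V = k.
Proof. by move/size_basis => ->; rewrite card_ord. Qed.

End Columns.

(** * Separation of the spectrum *)

Section Split.
Variable K : fieldType.
Implicit Types D : pred K.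

(** The first diagonal block takes the eigenvalues in [D], the second one all others, infinity
    included since [F1] is invertible. The block sizes come out of an induction, hence the equation
    [e] and the casts, which [subst] later removes. *)
Definition spectral_split D N (E F : 'M[K]_N) : Prop :=
  exists k m (e : (k + m)%N = N) (P Q : 'M[K]_(k + m))
    (E1 F1 : 'M[K]_k) (E2 F2 : 'M[K]_m) (E3 F3 : 'M[K]_(k, m)),
    [/\ P \in unitmx, Q \in unitmx &
        castmx (esym e, esym e) E = P *m block_mx E1 E3 0 E2 *m Q /\
        castmx (esym e, esym e) F = P *m block_mx F1 F3 0 F2 *m Q] /\
    [/\ F1 \in unitmx,
        forall z, ~~ D z -> \det (pencil E1 F1 z) != 0 &
        forall z, D z -> \det (pencil E2 F2 z) != 0].

(** In the rank factorisation of a nonzero column, the right factor is a nonzero scalar [c] and the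
    middle one the first unit vector, so [c] times the left factor sends that vector to [v]. *)
Lemma complete_column n (v : 'cV[K]_(1 + n)) : v != 0 ->
  exists2 Q : 'M[K]_(1 + n), Q \in unitmx & Q *m col_mx 1%:M 0 = v.
Proof.
move=> v0; pose c := row_ebase v 0 0.
have uc : row_ebase v = c%:M by rewrite [LHS]mx11_scalar.
have r1 : \rank v = 1%N.
  by apply/eqP; rewrite eqn_leq rank_leq_col lt0n mxrank_eq0.
have c0 : c != 0.
  by have := row_ebase_unit v; rewrite uc unitmxE det_scalar1 unitfE.
exists (c *: col_ebase v).
  by rewrite -mul_scalar_mx unitmx_mul col_ebase_unit andbT unitmxE det_scalar unitfE expf_neq0.
rewrite -[RHS]mulmx_ebase uc r1 mul_mx_scalar -scalemxAl; congr (_ *: (_ *m _)).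
rewrite -[LHS]/(col_mx 1%:M 0); apply/matrixP => i j; rewrite !mxE (ord1 j).
by case: splitP => i' ei; rewrite !mxE ei ?(ord1 i').
Qed.

(** A kernel vector u of E + zF satisfies E u = -z F u. With u and F u completed to bases, the first
    columns of E and F become -z and 1 times the first unit vector. *)
Lemma peel_eigenvector n (E F : 'M[K]_(1 + n)) z :
  regular_pencil E F -> \det (pencil E F z) = 0 ->
  exists (P Q : 'M[K]_(1 + n)) (x y : 'rV[K]_n) (E' F' : 'M[K]_n),
    [/\ P \in unitmx, Q \in unitmx,
        E = P *m block_mx (- z)%:M x 0 E' *m Q &
        F = P *m block_mx 1%:M y 0 F' *m Q].
Proof.
move=> reg dz; have [u u0 uz] : exists2 v : 'cV_(1 + n), v != 0 & pencil E F z *m v = 0.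
  have /det0P[v v0 vz] : \det (pencil E F z)^T == 0 by rewrite det_tr dz.
  exists v^T; first by rewrite trmx_eq0.
  by rewrite -[LHS]trmxK trmx_mul trmxK vz trmx0.
have Eu : E *m u = - z *: (F *m u).
  by apply/eqP; rewrite scaleNr -addr_eq0 scalemxAl -mulmxDl -/(pencil E F z) uz.
(* If F u = 0 then E u = 0, so E + XF kills a nonzero constant vector; multiplying by the adjugate
   gives det(E + XF) = 0, against regularity. *)
have w0 : F *m u != 0.
  apply: contraNneq reg => w0; rewrite w0 scaler0 in Eu.
  have Mu : (map_mx polyC E + 'X *: map_mx polyC F) *m map_mx polyC u = 0.
    by rewrite mulmxDl -scalemxAl -!map_mxM Eu w0 !map_mx0 scaler0 addr0.
  have := congr1 (mulmx (\adj (map_mx polyC E + 'X *: map_mx polyC F))) Mu.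
  rewrite mulmxA mul_adj_mx mulmx0 mul_scalar_mx => /eqP.
  by rewrite scalemx_eq0 map_mx_eq0 (negPf u0) orbF.
have [Q uQ Qu] := complete_column u0; have [P uP Pw] := complete_column w0.
pose G := invmx P *m E *m Q; pose H := invmx P *m F *m Q.
have colH : H *m col_mx 1%:M 0 = col_mx 1%:M 0.
  by rewrite /H -!mulmxA Qu -Pw mulKmx.
have colG : G *m col_mx 1%:M 0 = - z *: col_mx 1%:M 0.
  by rewrite /G -!mulmxA Qu Eu -Pw -scalemxAr mulKmx.
have blockE (A : 'M[K]_(1 + n)) c : A *m col_mx 1%:M 0 = c *: col_mx 1%:M 0 ->
    A = block_mx c%:M (ursubmx A) 0 (drsubmx A).
  rewrite -{1}[A]submxK mul_block_col !mulmx1 !mulmx0 !addr0 scale_col_mx scaler0.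
  by move=> /eq_col_mx[ul dl]; rewrite -{1}[A]submxK ul dl scale_scalar_mx mulr1.
exists P, (invmx Q), (ursubmx G), (ursubmx H), (drsubmx G), (drsubmx H).
split=> //; first by rewrite unitmx_inv.
  by rewrite -blockE// /G !mulmxA mulmxV// mul1mx mulmxK.
by rewrite -blockE ?scale1r// /H !mulmxA mulmxV// mul1mx mulmxK.
Qed.

(** Eigenvalues in [D] are peeled off one at a time; once none is left, the whole remaining pencil
    is the second block and the first one is empty. *)
Lemma spectral_splitP D N (E F : 'M[K]_N) :
  regular_pencil E F -> spectral_split D E F.
Proof.
elim: N E F => [|n IH] E F reg.
  exists 0%N, 0%N, erefl, 1%:M, 1%:M, E, F, E, F, E, F; split; first split.
  - exact: unitmx1.
  - exact: unitmx1.
  - by split; rewrite [LHS]flatmx0 [RHS]flatmx0.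
  - by split=> [|z _|z _]; rewrite ?unitmxE det_mx00 ?unitr1 ?oner_eq0.
have [[z Dz rz]|nz] := pselect (exists2 z, D z & \det (pencil E F z) = 0%R); last first.
  exists 0%N, n.+1, erefl, 1%:M, 1%:M, 0, 0, E, F, 0, 0; split; first split.
  - exact: unitmx1.
  - exact: unitmx1.
  - rewrite !castmx_id !mul1mx !mulmx1.
    have blockE (A : 'M[K]_(0 + n.+1)) : A = block_mx (0 : 'M[K]_0) 0 0 A.
      rewrite -[LHS]submxK; congr block_mx; rewrite ?[LHS]flatmx0 ?[LHS]thinmx0//.
      by apply/matrixP => i j; rewrite !mxE; congr (A _ _); apply: val_inj.
    by split; exact: blockE.
  - split=> [|z _|z Dz]; rewrite ?unitmxE ?det_mx00 ?unitr1 ?oner_eq0//.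
    by apply/eqP => d0; apply: nz; exists z.
have [P [Q [x [y [E' [F' [uP uQ EE FE]]]]]]] := @peel_eigenvector n E F z reg rz.
have reg' : regular_pencil E' F'.
  apply: contraNneq reg => r0; rewrite EE FE pencil_poly_mul (@pencil_poly_block _ 1 n) r0.
  by rewrite mulr0 scaler0.
have [k [m [e [P2 [Q2 [E1 [F1 [E2 [F2 [E3 [F3]]]]]]]]]]] := IH _ _ reg'.
move=> [[uP2 uQ2 [EE' FE']] [uF1 n1 n2]]; subst n; rewrite !castmx_id in EE' FE'.
(* The inner factors [P2] and [Q2] move into the outer ones, which costs the row [v] a factor
   [invmx Q2]; the blocks 1 + (k + m) are then regrouped as (1 + k) + m. *)
have step (a : 'M[K]_1) (v : 'rV[K]_(k + m)) B1 B3 B2 :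
    P *m block_mx a v 0 (P2 *m block_mx B1 B3 0 B2 *m Q2) *m Q =
    (P *m block_mx 1%:M 0 0 P2) *m
      (block_mx (block_mx a (lsubmx (v *m invmx Q2)) 0 B1)
        (col_mx (rsubmx (v *m invmx Q2)) B3) 0 B2 : 'M[K]_(1 + k + m)) *m
    (block_mx 1%:M 0 0 Q2 *m Q).
  set V := v *m invmx Q2.
  have blockA : block_mx a V 0 (block_mx B1 B3 0 B2) =
      block_mx (block_mx a (lsubmx V) 0 B1) (col_mx (rsubmx V) B3) 0 B2 :> 'M[K]_(1 + k + m).
    have := @block_mxA _ 1 k m 1 k m a (lsubmx V) (rsubmx V) 0 B1 B3 0 0 B2.
    by rewrite /= castmx_id hsubmxK col_mx0 row_mx0.
  have -> : block_mx a v 0 (P2 *m block_mx B1 B3 0 B2 *m Q2) =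
      block_mx 1%:M 0 0 P2 *m block_mx a V 0 (block_mx B1 B3 0 B2) *m block_mx 1%:M 0 0 Q2.
    rewrite !mulmx_block !mul1mx !mulmx1 !mul0mx !mulmx0 !addr0 !add0r.
    by rewrite mulmxKV.
  by rewrite -blockA !mulmxA.
have uB (U : 'M[K]_(k + m)) : U \in unitmx -> block_mx (1%:M : 'M[K]_1) 0 0 U \in unitmx.
  by move=> uU; rewrite unitmxE det_ublock det1 mul1r -unitmxE.
exists (1 + k)%N, m, erefl, (P *m block_mx 1%:M 0 0 P2), (block_mx 1%:M 0 0 Q2 *m Q).
do 6!eexists; split; first split.
- by rewrite unitmx_mul uP uB.
- by rewrite unitmx_mul uQ uB.
- by rewrite !castmx_id; split; [rewrite EE EE'|rewrite FE FE']; exact: step.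
split=> //.
- by rewrite unitmxE det_ublock det1 mul1r -unitmxE.
(* The new diagonal entry at [c] is c - z, nonzero because z lies in [D] and [c] does not. *)
- move=> c nDc; rewrite /pencil scale_block_mx add_block_mx scaler0 addr0 det_ublock.
  rewrite mulf_neq0 ?n1// scale_scalar_mx mulr1 -raddfD det_scalar1 addrC subr_eq0.
  by apply: contraNneq nDc => ->.
Qed.

End Split.

(** * Stable deflating subspaces *)

Lemma colspan_mulmx_sub (K : fieldType) N k l (X : 'M[K]_(N, k)) (Z : 'M[K]_(k, l)) :
  (colspan (X *m Z) <= colspan X)%VS.
Proof.
apply/subvP => v /colspanP[u ->]; apply/colspanP; exists (Z *m u).
by rewrite mulmxA.
Qed.

(** Equal multiplicities make the two lists of roots permutations of each other. This is how
    eigenvalue counts become equalities of dimensions. *)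
Lemma size_eq_mup (K : closedFieldType) (p q : {poly K}) : p != 0 -> q != 0 ->
  (forall a, mup a p = mup a q) -> size p = size q.
Proof.
move=> p0 q0 pq.
have [s sE] := closed_field_poly_normal p; have [t tE] := closed_field_poly_normal q.
have mupE (r : {poly K}) u a : r != 0 ->
    r = lead_coef r *: \prod_(z <- u) ('X - z%:P) -> mup a r = count_mem a u.
  rewrite -lead_coef_eq0 => r0 ->; rewrite -mul_polyC mupMr ?mu_prod_XsubC//.
  by rewrite rootC.
have /perm_size st : perm_eq s t.
  by apply/allP => a _ /=; rewrite -(mupE p) -?(mupE q)// pq.
by rewrite sE tE !size_scale ?lead_coef_eq0// !size_prod_XsubC st.
Qed.

Section Stable.
Local Open Scope complex_scope.
Variable R : realType.

(** What the rest of the proof retains of the block form. As F X = Y F1, the fourth identity says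
    that [contour E F *m F] fixes the columns of [X]. *)
Definition stable_splitting N (E F : 'M[R[i]]_N) k (X Y : 'M[R[i]]_(N, k))
    (E1 F1 : 'M[R[i]]_k) (Z : 'M[R[i]]_(k, N)) : Prop :=
  [/\ E *m X = Y *m E1, F *m X = Y *m F1, contour E F = X *m Z &
      contour E F *m Y *m F1 = X] /\
  [/\ forall u : 'cV_k, X *m u = 0 -> u = 0,
      forall u : 'cV_k, Y *m u = 0 -> u = 0,
      F1 \in unitmx &
      forall a, mup a (pencil_poly E1 F1) =
        if `|a| < 1 then mup a (pencil_poly E F) else 0%N].

Lemma stable_splittingP N (E F : 'M[R[i]]_N) : non_critical E F ->
  exists k X Y E1 F1 Z, @stable_splitting N E F k X Y E1 F1 Z.
Proof.
move=> nc; have reg : regular_pencil E F.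
  by apply: (@regular_pencilP _ _ _ _ 1); apply: nc; rewrite normr1.
have [k [m [e [P [Q [E1 [F1 [E2 [F2 [E3 [F3]]]]]]]]]]] :=
  spectral_splitP (fun z : R[i] => `|z| < 1) reg.
move=> [[uP uQ [EE FE]] [uF1 n1 n2]]; subst N; rewrite !castmx_id in EE FE.
have ppE : pencil_poly E F = (\det P * \det Q) *: (pencil_poly E1 F1 * pencil_poly E2 F2).
  by rewrite EE FE pencil_poly_mul pencil_poly_block.
have {}n1 z : 1 <= `|z| -> \det (pencil E1 F1 z) != 0.
  by move=> z1; apply: n1; rewrite -real_leNgt ?normr_real.
have nc1 : non_critical E1 F1 by move=> z z1; rewrite n1 ?z1.
have nc2 : non_critical E2 F2.
  move=> z /nc; rewrite -!horner_pencil_poly ppE hornerZ hornerM.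
  by rewrite !mulf_eq0 !negb_or => /and3P[].
have {}n2 z : `|z| <= 1 -> \det (pencil E2 F2 z) != 0.
  by rewrite le_eqVlt => /orP[/eqP/nc2|/n2].
pose X := lsubmx (invmx Q); pose Y := lsubmx P.
pose L := dsubmx Q; pose L' := dsubmx (invmx P).
have shiftr A B1 B3 B2 : A = P *m block_mx B1 B3 0 B2 *m Q -> A *m X = Y *m B1.
  move=> AE; have : A *m invmx Q = P *m block_mx B1 B3 0 B2 by rewrite AE mulmxK.
  rewrite -[invmx Q]hsubmxK -[P]hsubmxK mul_mx_row mul_row_block => /eq_row_mx[-> _].
  by rewrite mulmx0 addr0.
have shiftl A B1 B3 B2 : A = P *m block_mx B1 B3 0 B2 *m Q -> L' *m A = B2 *m L.
  move=> AE; have : invmx P *m A = block_mx B1 B3 0 B2 *m Q by rewrite AE -mulmxA mulKmx.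
  rewrite -[invmx P]vsubmxK -[Q]vsubmxK mul_col_mx mul_block_col => /eq_col_mx[_ ->].
  by rewrite mul0mx add0r.
have LC : L *m contour E F = 0.
  rewrite (contour_intertwine_l nc nc2 (shiftl _ _ _ _ EE) (shiftl _ _ _ _ FE)).
  suff -> : contour E2 F2 = 0 by rewrite mul0mx.
  apply: contour_analytic; rewrite ?oner_eq0//.
  by rewrite mul1r /expi mulrC mulr_natr cos2pi sin2pi.
(* The lower rows of Q C vanish by [LC], so C = Q^-1 (Q C) involves only the first columns [X] of
   Q^-1, multiplied by the upper rows of Q C. *)
exists k, X, Y, E1, F1, (usubmx Q *m contour E F); split; split.
- exact: shiftr EE.
- exact: shiftr FE.
- have QC : Q *m contour E F = col_mx (usubmx Q *m contour E F) 0.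
    by rewrite -LC -mul_col_mx vsubmxK.
  by rewrite -[LHS](mulKmx uQ) QC -[invmx Q]hsubmxK mul_row_col mulmx0 addr0.
- rewrite (contour_intertwine nc nc1 (shiftr _ _ _ _ EE) (shiftr _ _ _ _ FE)).
  by rewrite -mulmxA contour_stable// mulmx1.
- move=> u Xu; have : invmx Q *m col_mx u 0 = 0.
    by rewrite -[invmx Q]hsubmxK mul_row_col mulmx0 addr0.
  move/(congr1 (mulmx Q)); rewrite mulKVmx// mulmx0 => /(congr1 usubmx).
  by rewrite col_mxKu linear0.
- move=> u Yu; have : P *m col_mx u 0 = 0.
    by rewrite -[P]hsubmxK mul_row_col mulmx0 addr0.
  move/(congr1 (mulmx (invmx P))); rewrite mulKmx// mulmx0 => /(congr1 usubmx).
  by rewrite col_mxKu linear0.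
- exact: uF1.
(* Inside the disk det(E2 + zF2) has no root, so the multiplicity comes from the first block alone;
   outside, det(E1 + zF1) has none. *)
move=> a; have [a1|a1] := boolP (`|a| < 1).
  rewrite ppE -mul_polyC mupMr; last first.
    by rewrite rootC mulf_neq0// -unitfE -unitmxE.
  by rewrite mupMl// /root horner_pencil_poly n2// ltW.
by rewrite mupNroot// /root horner_pencil_poly n1// real_leNgt ?normr_real.
Qed.

Lemma stable_deflating_intro N (E F : 'M[R[i]]_N) (V W : {vspace 'cV[R[i]]_N}) k
    (X Y : 'M[R[i]]_(N, k)) (E1 F1 : 'M[R[i]]_k) :
  regular_pencil E F -> columns_basis V X -> columns_basis W Y ->
  E *m X = Y *m E1 -> F *m X = Y *m F1 ->
  (forall z, eigen_mult E1 F1 z = if in_open_disk z then eigen_mult E F z else 0%N) ->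
  is_stable_deflating E F V.
Proof.
move=> reg bX bY eE eF em; have dV := columns_basis_dim bX.
have [VE _] := (columns_basisP _ _).1 bX; have [WE _] := (columns_basisP _ _).1 bY.
have imW A B1 : A *m X = Y *m B1 -> forall v, v \in V -> A *m v \in W.
  move=> AX v; rewrite VE => /colspanP[u ->]; rewrite WE mulmxA AX.
  by apply/colspanP; exists (B1 *m u); rewrite mulmxA.
split; first split=> //.
  exists W; split; first by rewrite dV (columns_basis_dim bY).
    exact: imW eE.
  exact: imW eF.
by subst k; exists E1, F1; split=> //; exists W, X, Y.
Qed.

Lemma stable_splitting_deflating N (E F : 'M[R[i]]_N) k X Y E1 F1 Z :
  non_critical E F -> @stable_splitting N E F k X Y E1 F1 Z ->
  is_stable_deflating E F (colspan X).
Proof.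
move=> nc [[eE eF _ _] [iX iY uF1 mE]].
apply: (@stable_deflating_intro _ _ _ _ (colspan Y) _ X Y E1 F1) => //.
- by apply: (@regular_pencilP _ _ _ _ 1); apply: nc; rewrite normr1.
- exact/columns_basisP.
- exact/columns_basisP.
(* At infinity: [F1] is invertible, so det(E1 + zF1) has degree k and the multiplicity is k - k. *)
- by move=> [a|] /=; rewrite ?mE// size_pencil_poly// subnn.
Qed.

Lemma stable_deflating_unique N (E F : 'M[R[i]]_N) k X Y E1 F1 Z S :
  non_critical E F -> @stable_splitting N E F k X Y E1 F1 Z ->
  is_stable_deflating E F S -> S = colspan X.
Proof.
move=> nc [[eE eF CE CX] [iX iY uF1 mE]] [_ [E' [F' [[W [X' [Y' [bX' bY' eE' eF']]]] em]]]].
(* Multiplicity 0 at infinity forces full degree. The predecessor of the size confuses the zero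
   polynomial with a constant only in dimension 0, where the determinant is 1. *)
have sz : size (pencil_poly E' F') = (\dim S).+1.
  apply/eqP; rewrite eqn_leq size_pencil_poly_le ltnNge; apply/negP => sle.
  have := em None; rewrite /= => /eqP; rewrite subn_eq0 => lS.
  case: (\dim S) E' F' {X' Y' bX' bY' eE' eF' em} sle lS => [|d] E' F' sle lS.
    by move: sle; rewrite leqn0 size_poly_eq0 /pencil_poly det_mx00 oner_eq0.
  by case: (size _) sle lS => // c sle /(leq_trans sle); rewrite ltnn.
have uF' := unitmx_pencil sz.
have mupE a : mup a (pencil_poly E' F') = mup a (pencil_poly E1 F1).
  by rewrite mE; exact: (em (Some a)).
have dS : \dim S = k.
  apply/eqP; rewrite -eqSS -sz -(size_pencil_poly E1 uF1); apply/eqP.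
  by apply: size_eq_mup => //; rewrite -size_poly_eq0 ?sz ?size_pencil_poly.
have n' z : 1 <= `|z| -> \det (pencil E' F' z) != 0.
  move=> z1; rewrite -horner_pencil_poly; apply/negP => /eqP rz.
  have := em (Some z); rewrite /= real_ltNge ?normr_real// z1 /= => /eqP.
  rewrite -leqn0 leqNgt mup_geq -?size_poly_eq0 ?sz// expr1 dvdp_XsubCl /root rz.
  by rewrite eqxx.
have nc' : non_critical E' F' by move=> z z1; rewrite n' ?z1.
have [SE _] := (columns_basisP _ _).1 bX'.
(* Intertwining with E' + zF', whose eigenvalues all lie in the disk, gives C F X' = X'; then C = X
   Z puts S inside the span of [X], and the dimensions agree. *)
have X'E : X' = X *m (Z *m Y' *m F').
  by rewrite !mulmxA -CE (contour_intertwine nc nc' eE' eF') -mulmxA contour_stable// mulmx1.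
apply/eqP; rewrite eqEdim {1}SE {1}X'E colspan_mulmx_sub/= dS.
by have /columns_basis_dim -> : columns_basis (colspan X) X by exact/columns_basisP.
Qed.

Lemma stable_splitting_projector N (E F : 'M[R[i]]_N) k X Y E1 F1 Z :
  @stable_splitting N E F k X Y E1 F1 Z ->
  range_mx (contour E F) = colspan X /\ projector_onto (contour E F *m F) (colspan X).
Proof.
move=> [[_ eF CE CX] _].
have CFX : contour E F *m F *m X = X by rewrite -mulmxA eF mulmxA.
(* F is a generalised inverse of C: C F fixes [X], and C = X Z. Idempotency of C F follows. *)
have CFC : contour E F *m F *m contour E F = contour E F.
  by rewrite {2}CE mulmxA CFX -CE.
have sub1 : (colspan (contour E F *m F *m X) <= colspan (contour E F))%VS.
  by rewrite -mulmxA colspan_mulmx_sub.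
have sub2 := colspan_mulmx_sub (contour E F *m F) X.
rewrite CFX in sub1 sub2.
split; last split; last 2 first.
- by rewrite mulmxA CFC.
- rewrite -[LHS]/(colspan (contour E F *m F)); apply/eqP; rewrite eqEsubv sub2 andbT.
  by rewrite CE -mulmxA colspan_mulmx_sub.
rewrite -[LHS]/(colspan (contour E F)); apply/eqP; rewrite eqEsubv sub1 andbT.
by rewrite CE colspan_mulmx_sub.
Qed.

End Stable.

Theorem theorem12 (R : realType) (n : nat) (A B C D : 'M[R]_n)
    (M : 'M[R[i]]_(n + n)) (hM : M = block_matrix A B C D)
    (hcrit : non_critical M M^T) :
  unique (is_stable_deflating M M^T) (range_mx (contour_matrix M)) /\
  (forall S : {vspace 'cV[R[i]]_(n + n)},
     is_stable_deflating M M^T S ->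
     projector_onto (contour_matrix M *m M^T) S).
Proof.
have [k [X [Y [E1 [F1 [Z sp]]]]]] := stable_splittingP hcrit.
have [rE pr] := stable_splitting_projector sp.
have uniq S : is_stable_deflating M M^T S -> S = colspan X.
  exact: stable_deflating_unique hcrit sp.
rewrite contour_matrixE// rE; split; last by move=> S /uniq ->.
split; first exact: stable_splitting_deflating hcrit sp.
by move=> S /uniq.
Qed.
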